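(* Let $\mathcal{H}$ be a complex separable Hilbert space. Suppose that $(\mathbf{u}_j)_{j\ge1}$ is an orthonormal basis for $\mathcal{H}$ (indexed by $\mathbb{N}=\{1,2,\ldots\}$), $(\xi_j)_{j\ge1}$ is a sequence of unimodular constants, and $U$ is the unitary operator on $\mathcal{H}$ defined by $$U:=\sum_{j\ge1}\xi_j(\mathbf{u}_j\otimes\mathbf{u}_j).$$ For any bijection $\sigma:\mathbb{N}\to\mathbb{N}$ with $\sigma\circ\sigma=\operatorname{id}$, the unitary operator $U_\sigma$ on $\mathcal{H}$ defined by $$U_\sigma:=\sum_{j\ge1}\bar\xi_{\sigma(j)}(\mathbf{u}_j\otimes\mathbf{u}_j)$$ belongs to $\mathfrak{O}_c(U)$.
   Context: A conjugation on a complex Hilbert space is an antilinear, isometric map $C$ with $C^2=I$. For a unitary operator $U$ on $\mathcal{H}$, the conjugate orbit is $\mathfrak{O}_c(U)=\{CUC: C \text{ a conjugation on } \mathcal{H}\}$. For $\mathbf{a},\mathbf{b}\in\mathcal{H}$, $\mathbf{a}\otimes\mathbf{b}$ is the operator $\mathbf{x}\mapsto\langle\mathbf{x},\mathbf{b}\rangle\mathbf{a}$; the sums converge in the strong operator topology. *)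

(* Defs.v *)
From mathcomp Require Import all_boot all_order all_algebra.
From mathcomp.real_closed Require Import complex.
From mathcomp Require Import all_classical all_reals all_analysis.
Set Implicit Arguments.
Unset Strict Implicit.
Unset Printing Implicit Defensive.
Import Order.TTheory GRing.Theory Num.Theory.
Import numFieldNormedType.Exports.
Local Open Scope classical_set_scope.
Local Open Scope ring_scope.

(* An operator is a bare map H -> H carrying its linearity as a hypothesis.
   The inner product is linear in its first argument, antilinear in its second. *)
Section HilbertSpace.
Context {R : realType} {H : completeNormedModType R[i]}.
Implicit Types (dot : {dot H for @Num.conj R[i]}) (u : nat -> H).

Definition separable := exists2 A : set H, countable A & dense A.

Definition span (u : nat -> H) : set H :=
  [set x | exists n (a : 'I_n -> R[i]), x = \sum_(j < n) a j *: u j].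

Definition orthonormal_basis dot u :=
  (forall i j, dot (u i) (u j) = (i == j)%:R) /\ closure (span u) = setT.

Definition tensor dot (a b : H) : H -> H := fun x => dot x b *: a.

(* Series of operators in the strong operator topology, that is pointwise on
   vectors for the norm of H; [sot_series] is the sum only under
   [sot_summable], since [lim] is total. *)
Definition sot_summable (T : nat -> H -> H) :=
  forall x, cvgn (series (fun j => T j x)).

Definition sot_series (T : nat -> H -> H) : H -> H :=
  fun x => limn (series (fun j => T j x)).

Definition is_adjoint dot (T S : H -> H) :=
  forall x y, dot (T x) y = dot x (S y).

Definition unitary dot (U : H -> H) :=
  [/\ linear U, continuous U &
      exists V, [/\ is_adjoint dot U V, V \o U = id & U \o V = id]].

Definition antilinear (C : H -> H) := linear_for (Num.conj \; *:%R) C.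

Definition conjugation (C : H -> H) :=
  [/\ antilinear C, forall x, `|C x| = `|x| & C \o C = id].

Definition conjugate_orbit (U : H -> H) : set (H -> H) :=
  [set C \o U \o C | C in [set C | conjugation C]].

End HilbertSpace.

(* Main.v *)
Require Import Defs.
From mathcomp Require Import all_boot all_order all_algebra.
From mathcomp.real_closed Require Import complex.
From mathcomp Require Import all_classical all_reals all_analysis.
Import Order.TTheory GRing.Theory Num.Theory.
Import numFieldNormedType.Exports.
Local Open Scope classical_set_scope.
Local Open Scope ring_scope.

(* Let C be the antilinear map with C u_j = u_(sigma j), that is
   C x = sum_j conj <x, u_(sigma j)> u_j; the series converges by Bessel's
   inequality and completeness, and C is a conjugation because sigma is an
   involution. Comparing coordinates in the basis,
   <C U C x, u_j> = conj (xi (sigma j)) <x, u_j>, so C U C = U_sigma. *)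

(** * Cauchy-Schwarz inequality and continuity of the inner product *)

Section InnerProduct.
Context {R : realType} {H : completeNormedModType R[i]}.
Context (dot : {dot H for @Num.conj R[i]}).
Context (dot_norm : forall x : H, dot x x = `|x| ^+ 2).

Lemma dot_conj x y : dot x y = (dot y x)^*.
Proof. by rewrite hermC mul1r. Qed.

Lemma dotZl a x y : dot (a *: x) y = a * dot x y.
Proof. by rewrite linearZl_LR. Qed.

Lemma dotZr a x y : dot x (a *: y) = a^* * dot x y.
Proof. by rewrite linearZr_LR. Qed.

(** Subtract from [x] its projection onto [y]: the squared norm of the difference is nonnegative and
    expands to [|x|^2 - q], with [q = |<x,y>|^2 / |y|^2]. *)
Lemma dot_cauchy_schwarz x y : `|dot x y| <= `|x| * `|y|.
Proof.
have [->|y0] := eqVneq y 0; first by rewrite linear0r !normr0 mulr0.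
have y2_gt0 : 0 < `|y| ^+ 2 by rewrite exprn_gt0 ?normr_gt0.
rewrite -(@ler_pXn2r _ 2) ?nnegrE ?mulr_ge0// exprMn -ler_pdivrMr//.
set q := _ / _; have q_real : q^* = q.
  by apply: conj_Creal; rewrite realM ?realV ?realX// normr_real.
have := dnorm_ge0 dot (x - (dot x y / `|y| ^+ 2) *: y).
rewrite dnormB dnormZ dotZr !dot_norm.
have -> : (dot x y / `|y| ^+ 2)^* * dot x y = q.
  rewrite rmorphM mulrAC -normCKC; congr (_ * _).
  by apply: conj_Creal; rewrite realV realX// normr_real.
have -> : `|dot x y / `|y| ^+ 2| ^+ 2 * `|y| ^+ 2 = q.
  rewrite normf_div (gtr0_norm y2_gt0) /q.
  move: (`|y| ^+ 2) y2_gt0 => N N_gt0.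
  by rewrite expr_div_n [N ^+ 2]expr2 invfM mulrA mulfVK// gt_eqF.
by rewrite q_real opprD addrA addrK subr_ge0.
Qed.

Lemma cvg_dotl (f : nat -> H) l y :
  f @ \oo --> l -> dot (f n) y @[n --> \oo] --> dot l y.
Proof.
move=> fl; apply/cvgrPdist_le => e e0.
(* Adding 1 keeps the divisor positive even when [y = 0]. *)
have d0 : 0 < e / (`|y| + 1) by rewrite divr_gt0// ltr_wpDl.
near=> n; rewrite -linearBl (le_trans (dot_cauchy_schwarz _ _))//.
rewrite (@le_trans _ _ (e / (`|y| + 1) * (`|y| + 1)))//; last first.
  by rewrite divfK// gt_eqF// ltr_wpDl.
rewrite ler_pM// ?lerDl//; near: n.
by move/cvgrPdist_le : fl; apply.
Unshelve. all: by end_near. Qed.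

Lemma cvg_dotr (f : nat -> H) l x :
  f @ \oo --> l -> dot x (f n) @[n --> \oo] --> dot x l.
Proof.
move=> /(@cvg_dotl f l x)/cvgrPdist_le fl; apply/cvgrPdist_le => e e0.
move: (fl e e0); apply: filterS => n.
by rewrite (dot_conj x l) (dot_conj x (f n)) -rmorphB norm_conjC.
Qed.

(** * Orthonormal sequences: Bessel's inequality and convergence of series *)

Section Orthonormal.
Context (e : nat -> H).
Context (e_orthonormal : forall i j, dot (e i) (e j) = (i == j)%:R).

Lemma dot_sum_orthonormal (a : nat -> R[i]) m n j :
  dot (\sum_(m <= k < n) a k *: e k) (e j) =
  if (m <= j < n)%N then a j else 0.
Proof.
(* The conditional becomes a sum over [k] filtered by [k == j], so that both sides can be compared
   term by term. *)
rewrite linear_sumlz -(big_nat1_eq +%R) [RHS]big_mkcond; apply: eq_bigr => k _ /=.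
by rewrite dotZl e_orthonormal; case: eqP => [->|_]; rewrite ?mulr1 ?mulr0.
Qed.

Lemma norm_sum_orthonormal (a : nat -> R[i]) m n :
  `|\sum_(m <= k < n) a k *: e k| ^+ 2 = \sum_(m <= k < n) `|a k| ^+ 2.
Proof.
rewrite -dot_norm linear_sumr; apply: eq_big_nat => k mkn /=.
by rewrite dotZr dot_sum_orthonormal mkn -normCKC.
Qed.

(** The partial expansion [s] satisfies [<x,s> = |s|^2], so [0 <= |x - s|^2 = |x|^2 - |s|^2]. *)
Lemma bessel x n : \sum_(0 <= k < n) `|dot x (e k)| ^+ 2 <= `|x| ^+ 2.
Proof.
set s := \sum_(0 <= k < n) dot x (e k) *: e k.
have sE : `|s| ^+ 2 = \sum_(0 <= k < n) `|dot x (e k)| ^+ 2.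
  exact: norm_sum_orthonormal.
have xs : dot x s = `|s| ^+ 2.
  rewrite sE linear_sumr; apply: eq_bigr => k _ /=.
  by rewrite dotZr -normCKC.
have := dnorm_ge0 dot (x - s); rewrite dnormB xs !dot_norm.
rewrite conj_Creal ?realX ?normr_real// opprD addrA addrK subr_ge0.
by rewrite sE.
Qed.

Lemma is_cvg_series_orthonormal (a : nat -> R[i]) (M : R[i]) :
  (forall n, \sum_(0 <= k < n) `|a k| ^+ 2 <= M) ->
  cvgn (series (fun k => a k *: e k)).
Proof.
move=> aM; apply/cauchy_cvgP/cauchy_seriesP => eps eps0.
(* The order on [R[i]] is only partial, so monotone convergence is applied in [R]; the [|a k|^2] are
   real, and taking real parts loses nothing. *)
pose b k := complex.Re (`|a k| ^+ 2).
have bE k : (b k)%:C%C = `|a k| ^+ 2.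
  by rewrite RRe_real// realX ?normr_real.
have bsumE m n : (\sum_(m <= k < n) b k)%:C%C = \sum_(m <= k < n) `|a k| ^+ 2.
  by rewrite rmorph_sum; apply: eq_bigr => k _; exact: bE.
have b_ge0 k : 0 <= b k by rewrite -lecR bE exprn_ge0.
have cb : cvgn (series b).
  apply: nondecreasing_is_cvgn.
    by apply: nondecreasing_series => k _ _; exact: b_ge0.
  exists (complex.Re M) => _ [n _ <-].
  by have := aM n; rewrite -bsumE lecE => /andP[].
(* A block of the series has squared norm equal to the matching block of [b], hence the tolerance
   [eps^2]. *)
pose d := complex.Re (eps ^+ 2).
have dE : d%:C%C = eps ^+ 2 by rewrite RRe_real// realX ?gtr0_real.
have d0 : 0 < d by rewrite -ltcR dE exprn_gt0.
have /cauchy_cvgP/cauchy_seriesP/(_ d d0) := cb.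
apply: filterS => -[m n] /=.
rewrite ger0_norm ?sumr_ge0// -ltcR bsumE dE -norm_sum_orthonormal.
by rewrite ltr_pXn2r// ?nnegrE// ltW.
Qed.

End Orthonormal.

(** * Orthonormal bases: vectors and their coordinates *)

Section Basis.
Context (u : nat -> H).
Context (u_basis : orthonormal_basis dot u).

Let u_orthonormal : forall i j, dot (u i) (u j) = (i == j)%:R := u_basis.1.

(** If [x] were nonzero, density would give [s] in the span with [|x - s| < |x|]; but [x] is
    orthogonal to [s], so Pythagoras gives [|x| <= |x - s|]. *)
Lemma orthonormal_basis_eq0 x : (forall j, dot x (u j) = 0) -> x = 0.
Proof.
move=> xu0; apply/eqP; rewrite -normr_eq0; apply: contraT => x0.
have : closure (Defs.span u) x by rewrite u_basis.2.
have x_gt0 : 0 < `|x| by rewrite lt_def x0 normr_ge0.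
move=> /(_ _ (nbhsx_ballx x _ x_gt0))[_ [[n [a ->]]]].
rewrite -ball_normE /=; set s := \sum_(_ < n) _ => xs.
have xs0 : dot x s = 0.
  by rewrite linear_sumr big1// => k _ /=; rewrite dotZr xu0 mulr0.
suff : `|x| <= `|x - s| by rewrite real_leNgt ?normr_real ?xs.
rewrite -(@ler_pXn2r _ 2) ?nnegrE// -!dot_norm dnormB xs0 conjC0.
by rewrite addr0 subr0 lerDl.
Qed.

Lemma orthonormal_basis_inj x y :
  (forall j, dot x (u j) = dot y (u j)) -> x = y.
Proof.
move=> xy; apply/subr0_eq/orthonormal_basis_eq0 => j.
by rewrite linearBl /= xy subrr.
Qed.

(** Injectivity keeps [u \o s] orthonormal, so Bessel bounds the coefficients. Taking [s] to be the
    identity serves diagonal operators, and an involution serves the conjugation. *)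
Lemma orthonormal_series (b : nat -> R[i]) (s : nat -> nat) x :
  injective s -> (forall j, `|b j| = `|dot x (u (s j))|) ->
  let S := series (fun j => b j *: u j) in
  [/\ cvgn S, forall j, dot (limn S) (u j) = b j & `|limn S| <= `|x|].
Proof.
move=> s_inj bE S.
have us_orthonormal i j : dot (u (s i)) (u (s j)) = (i == j)%:R.
  by rewrite u_orthonormal inj_eq.
have b_bound n : \sum_(0 <= k < n) `|b k| ^+ 2 <= `|x| ^+ 2.
  under eq_bigr do rewrite bE.
  exact: (bessel (u \o s) us_orthonormal).
have cS : cvgn S := is_cvg_series_orthonormal _ u_orthonormal _ _ b_bound.
split=> // [j|].
  apply: (cvg_unique _ (cvg_dotl _ _ (u j) cS)) => //.
  (* From index [j.+1] on, the partial sums contain the term [j], so their [j]-th coordinate is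
     constant. *)
  apply: cvg_near_cst; exists j.+1 => // n /= jn.
  by rewrite dot_sum_orthonormal// jn.
(* Every partial sum has norm at most [|x|], and some partial sum lies within [e] of the limit. *)
apply/ler_addgt0Pr => e e0.
have /cvgrPdist_le/(_ e e0)[N _ /(_ N (leqnn N)) SN] := cS.
rewrite -[limn S](subrK (S N)) (le_trans (ler_normD _ _))// addrC lerD//.
by rewrite -(@ler_pXn2r _ 2) ?nnegrE// norm_sum_orthonormal.
Qed.

(** * Diagonal unitary operators, covering both [U] and [U_sigma] *)

Definition diagonal (c : nat -> R[i]) : H -> H :=
  sot_series (fun j => c j \*: tensor dot (u j) (u j)).

Lemma diagonal_series c x : (forall j, `|c j| = 1) ->
  [/\ cvgn (series (fun j => (c j \*: tensor dot (u j) (u j)) x)),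
      forall j, dot (diagonal c x) (u j) = c j * dot x (u j)
    & `|diagonal c x| <= `|x|].
Proof.
move=> c1; rewrite /diagonal /sot_series.
have -> : (fun j => (c j \*: tensor dot (u j) (u j)) x) =
          (fun j => (c j * dot x (u j)) *: u j).
  by apply/funext => j; rewrite /= /tensor scalerA.
apply: (orthonormal_series _ id) => // j.
by rewrite normrM c1 mul1r.
Qed.

Lemma diagonal_summable c : (forall j, `|c j| = 1) ->
  sot_summable (fun j => c j \*: tensor dot (u j) (u j)).
Proof. by move=> c1 x; have [] := diagonal_series c x c1. Qed.

Lemma dot_diagonal c x j : (forall j, `|c j| = 1) ->
  dot (diagonal c x) (u j) = c j * dot x (u j).
Proof. by move=> c1; have [] := diagonal_series c x c1. Qed.

Lemma diagonal_linear c : (forall j, `|c j| = 1) -> linear (diagonal c).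
Proof.
move=> c1 a x y; apply: orthonormal_basis_inj => j.
by rewrite linearDl /= dotZl !dot_diagonal// linearDl /= dotZl mulrDr mulrCA.
Qed.

(** A linear contraction is 1-Lipschitz. *)
Lemma diagonal_continuous c : (forall j, `|c j| = 1) -> continuous (diagonal c).
Proof.
move=> c1 x; apply/cvgrPdist_le => e e0; near=> y.
have -> : diagonal c x - diagonal c y = diagonal c (x - y).
  apply: orthonormal_basis_inj => j.
  by rewrite linearBl /= !dot_diagonal// linearBl /= mulrBr.
have [_ _ /le_trans] := diagonal_series c (x - y) c1; apply.
by near: y; exact: cvgr_dist_le.
Unshelve. all: by end_near. Qed.

Lemma diagonalM c d : (forall j, `|c j| = 1) -> (forall j, `|d j| = 1) ->
  (forall j, c j * d j = 1) -> diagonal c \o diagonal d = id.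
Proof.
move=> c1 d1 cd; apply/funext => x; apply: orthonormal_basis_inj => j.
by rewrite /= !dot_diagonal// mulrA cd mul1r.
Qed.

Lemma diagonal_adjoint c : (forall j, `|c j| = 1) ->
  is_adjoint dot (diagonal c) (diagonal (fun j => (c j)^*)).
Proof.
move=> c1 x y.
have c1' j : `|(c j)^*| = 1 by rewrite norm_conjC.
have [/(cvg_dotl _ _ y) Ux _ _] := diagonal_series c x c1.
have [/(cvg_dotr _ _ x) Vy _ _] := diagonal_series _ y c1'.
(* The two sides are limits of partial sums that agree term by term. *)
apply: (cvg_unique _ Ux); first exact: norm_hausdorff.
apply: cvg_trans Vy; apply: near_eq_cvg; exists 0%N => // n _.
rewrite /series /= linear_sumlz linear_sumr; apply: eq_bigr => j _ /=.
by rewrite /tensor !dotZl !dotZr conjCK -dot_conj (mulrC (dot x _)).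
Qed.

Lemma diagonal_unitary c : (forall j, `|c j| = 1) -> unitary dot (diagonal c).
Proof.
move=> c1; have c1' j : `|(c j)^*| = 1 by rewrite norm_conjC.
have cc j : c j * (c j)^* = 1 by rewrite -normCK c1 expr1n.
split; [exact: diagonal_linear | exact: diagonal_continuous |].
exists (diagonal (fun j => (c j)^*)); split.
- exact: diagonal_adjoint.
- by apply: diagonalM => // j; rewrite mulrC.
- exact: diagonalM.
Qed.

(** * The conjugation permuting the basis *)

Section PermutedConjugation.
Context (s : nat -> nat).
Context (s_invol : involutive s).

Definition permuted_conjugation (x : H) : H :=
  limn (series (fun j => (dot x (u (s j)))^* *: u j)).

Lemma permuted_conjugation_spec x :
  (forall j, dot (permuted_conjugation x) (u j) = (dot x (u (s j)))^*) /\
  `|permuted_conjugation x| <= `|x|.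
Proof.
have [j|_ dotC normC] := orthonormal_series
  (fun j => (dot x (u (s j)))^*) s x (inv_inj s_invol).
  by rewrite norm_conjC.
by split.
Qed.

Let dot_pconj x j :
  dot (permuted_conjugation x) (u j) = (dot x (u (s j)))^* :=
  (permuted_conjugation_spec x).1 j.

Lemma permuted_conjugationK : involutive permuted_conjugation.
Proof.
move=> x; apply: orthonormal_basis_inj => j.
by rewrite !dot_pconj conjCK s_invol.
Qed.

(* Isometry needs no Parseval identity: Bessel's inequality makes the map
   contractive, and a contractive involution is isometric. *)
Lemma permuted_conjugationP : conjugation permuted_conjugation.
Proof.
split.
- move=> a x y; apply: orthonormal_basis_inj => j.
  by rewrite linearDl /= dotZl !dot_pconj linearDl /= dotZl rmorphD rmorphM.
- move=> x; apply: le_anti; rewrite (permuted_conjugation_spec x).2 /=.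
  rewrite -[leLHS](congr1 _ (permuted_conjugationK x)).
  exact: (permuted_conjugation_spec _).2.
- exact/funext/permuted_conjugationK.
Qed.

(** The outer map reads coordinate [s j] and conjugates it, which yields the factor [(c (s j))^*];
    on the coordinate of [x], the two conjugations and the two uses of [s] cancel. *)
Lemma permuted_conjugation_diagonal c : (forall j, `|c j| = 1) ->
  permuted_conjugation \o diagonal c \o permuted_conjugation =
  diagonal (fun j => (c (s j))^*).
Proof.
move=> c1; apply/funext => x; apply: orthonormal_basis_inj => j /=.
have c1' k : `|(c (s k))^*| = 1 by rewrite norm_conjC.
rewrite dot_pconj !dot_diagonal// dot_pconj s_invol.
by rewrite rmorphM /= conjCK.
Qed.

End PermutedConjugation.

End Basis.

End InnerProduct.

Theorem corollary2p12 (R : realType) (H : completeNormedModType R[i])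
    (dot : {dot H for @Num.conj R[i]})
    (dot_norm : forall x : H, dot x x = `|x| ^+ 2)
    (H_separable : separable (H := H))
    (u : nat -> H) (u_basis : orthonormal_basis dot u)
    (xi : nat -> R[i]) (xi_unimodular : forall j, `|xi j| = 1)
    (sigma : nat -> nat) (sigma_bij : bijective sigma)
    (sigma_inv : sigma \o sigma = id) :
  let T := fun j => xi j \*: tensor dot (u j) (u j) in
  let T_sigma := fun j => (xi (sigma j))^* \*: tensor dot (u j) (u j) in
  let U := sot_series T in
  let U_sigma := sot_series T_sigma in
  [/\ sot_summable T, unitary dot U, sot_summable T_sigma,
      unitary dot U_sigma & conjugate_orbit U U_sigma].
Proof.
have xi_conj j : `|(xi (sigma j))^*| = 1 by rewrite norm_conjC.
have sigma_invol : involutive sigma by move=> j; exact: (congr1 (fun f => f j) sigma_inv).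
split.
- exact: diagonal_summable.
- exact: diagonal_unitary.
- exact: diagonal_summable.
- exact: diagonal_unitary.
- exists (permuted_conjugation dot u sigma).
    exact: permuted_conjugationP.
  exact: permuted_conjugation_diagonal.
Qed.
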